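(* Let $p:\mathbb{R}^l\to\mathbb{R}$ be a polynomial in $l$ variables, and consider the problem $\min_{x\in\mathbf{u}}p(x)$ with $\mathbf{u}=[0,1]^l$. Suppose the Hessian $\nabla^2p$ is positive definite at some global minimizer $x^*$ of this problem, where $x^*$ is not on the boundary of $\mathbf{u}$. Then there are constants $C_1,C_2$ depending only on $p$ such that, for optimality tolerance $\epsilon>0$ and step tolerance $\delta>0$, the maximum number of iterations of the Parallel Constrained Bernstein Algorithm (PCBA) needed to solve the problem up to accuracy $\epsilon$ and $\delta$ (that is, to meet the stopping criterion given in the context) is $$N=\left\lceil\max\left\{-\log_2\delta,\; C_1,\; -\tfrac12\log_2\epsilon+C_2\right\}\right\rceil .$$
   Context: Boxes and Bernstein patches. A box is $\mathbf{x}=[\underline{x}_1,\overline{x}_1]\times\cdots\times[\underline{x}_l,\overline{x}_l]\subset\mathbb{R}^l$ with $\underline{x}_\mu<\overline{x}_\mu$; its maximum width is $|\mathbf{x}|=\max_\mu(\overline{x}_\mu-\underline{x}_\mu)$. The multi-degree $N=(n_1,\dots,n_l)$ of a polynomial $p$ records the largest power of each variable occurring in $p$. Over a box $\mathbf{x}$, $p$ is uniquely written $p(x)=\sum_{0\le J\le N}B_J^{(N)}(\mathbf{x})\,b_J^{(N)}(\mathbf{x},x)$, with $b_J^{(N)}(\mathbf{x},x)=\prod_{\mu=1}^l\binom{n_\mu}{j_\mu}\frac{(x_\mu-\underline{x}_\mu)^{j_\mu}(\overline{x}_\mu-x_\mu)^{n_\mu-j_\mu}}{(\overline{x}_\mu-\underline{x}_\mu)^{n_\mu}}$.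 The array of Bernstein coefficients $B_p(\mathbf{x})=(B_J^{(N)}(\mathbf{x}))_{J\le N}$ is the (Bernstein) patch of $p$ over $\mathbf{x}$; $\min B_p(\mathbf{x})$ and $\max B_p(\mathbf{x})$ are its smallest and largest entries. PCBA for the problem $\min_{x\in\mathbf{u}}p(x)$ (all points of $\mathbf{u}$ feasible). The algorithm maintains a list $\mathcal{L}$ of subboxes of $\mathbf{u}$ with their patches, starting with $\mathcal{L}=\{\mathbf{u}\}$. In each iteration, for $r=1,\dots,l$ in turn: every box in $\mathcal{L}$ is replaced by its two halves obtained by bisecting it in the $r$-th direction (with the corresponding patches), and then the cut-off test is applied: with $p^*_{\mathrm{up}}=\min_{\mathbf{x}\in\mathcal{L}}\max B_p(\mathbf{x})$, every $\mathbf{x}\in\mathcal{L}$ that is suboptimal, i.e. $\min B_p(\mathbf{x})>p^*_{\mathrm{up}}$, is removed. Thus after $n$ iterations every box in $\mathcal{L}$ has width $2^{-n}$. Stopping criterion: there is $\mathbf{x}\in\mathcal{L}$ with $|\mathbf{x}|\le\delta$ and $\max B_p(\mathbf{x})-\min B_p(\mathbf{y})\le\epsilon$ for all $\mathbf{y}\in\mathcal{L}$. User-imposed caps on memory and iteration count are disregarded. *)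

(* Defs.v *)
(* Points of R^l are row vectors in MathComp's 'rV[R]_l. *)
From HB Require Import structures.
From mathcomp Require Import all_boot all_order all_algebra.
From mathcomp Require Import all_classical all_reals all_analysis.
(* The notations of mpoly clash with those of MathComp-Analysis:
   {mpoly R[l]} is written mpoly l R, p.@[v] is meval v p, and p^`M(i) is
   mderiv i p. *)
From mathcomp Require Import -(notations) mpoly.

Set Implicit Arguments.
Unset Strict Implicit.
Unset Printing Implicit Defensive.

Import Order.TTheory GRing.Theory Num.Theory.
Import numFieldNormedType.Exports.
Local Open Scope classical_set_scope.
Local Open Scope ring_scope.

Section Boxes.
Context {R : realType} {l : nat}.

Record box := Box {
  box_ends : 'rV[R]_l * 'rV[R]_l;
  box_wf : [forall i, box_ends.1 0 i < box_ends.2 0 i] }.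

HB.instance Definition _ := [isSub for box_ends].
HB.instance Definition _ := [Choice of box by <:].

Definition lo (x : box) (i : 'I_l) : R := (box_ends x).1 0 i.
Definition hi (x : box) (i : 'I_l) : R := (box_ends x).2 0 i.

Lemma lo_lt_hi (x : box) (i : 'I_l) : lo x i < hi x i.
Proof. exact: (forallP (box_wf x) i). Qed.

Definition box_set (x : box) : set 'rV[R]_l :=
  [set z | forall i, lo x i <= z 0 i <= hi x i].

(* The widths are positive, so the neutral value 0 does not affect the max. *)
Definition box_width (x : box) : R := \big[Num.max/0]_i (hi x i - lo x i).

Fact unit_box_wf : [forall i : 'I_l, (const_mx 0 : 'rV[R]_l) 0 i <
                                     (const_mx 1 : 'rV[R]_l) 0 i].
Proof. by apply/forallP => i; rewrite !mxE ltr01. Qed.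

Definition unit_box : box := @Box (const_mx 0, const_mx 1) unit_box_wf.

Definition mid (x : box) (r : 'I_l) : R := (lo x r + hi x r) / 2.

Fact left_half_wf (x : box) (r : 'I_l) :
  [forall i, (\row_i lo x i) 0 i <
             (\row_i (if i == r then mid x r else hi x i)) 0 i].
Proof.
apply/forallP => i; rewrite !mxE; case: eqP => [->|_]; last exact: lo_lt_hi.
exact: (midf_lt (lo_lt_hi x r)).1.
Qed.

Fact right_half_wf (x : box) (r : 'I_l) :
  [forall i, (\row_i (if i == r then mid x r else lo x i)) 0 i <
             (\row_i hi x i) 0 i].
Proof.
apply/forallP => i; rewrite !mxE; case: eqP => [->|_]; last exact: lo_lt_hi.
exact: (midf_lt (lo_lt_hi x r)).2.
Qed.

Definition left_half (r : 'I_l) (x : box) : box :=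
  @Box (\row_i lo x i, \row_i (if i == r then mid x r else hi x i))
       (left_half_wf x r).

Definition right_half (r : 'I_l) (x : box) : box :=
  @Box (\row_i (if i == r then mid x r else lo x i), \row_i hi x i)
       (right_half_wf x r).

Definition bisect (r : 'I_l) (L : seq box) : seq box :=
  flatten [seq [:: left_half r x; right_half r x] | x <- L].

End Boxes.

Arguments box : clear implicits.

Section Bernstein.
Context {R : realType} {l : nat}.
Implicit Types (p : mpoly l R) (x : box R l) (z : 'rV[R]_l).

Definition peval p z : R := meval (fun i => z 0 i) p.

Definition multidegree p (i : 'I_l) : nat :=
  \max_(m <- msupp p) (m : multinom l) i.

(* The multi-indices J with 0 <= J <= N. *)
Definition multi_index (N : 'I_l -> nat) : finType :=
  {dffun forall i : 'I_l, 'I_(N i).+1}.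

Definition multi_index0 (N : 'I_l -> nat) : multi_index N := [ffun i => ord0].

Definition bernstein_basis (N : 'I_l -> nat) (J : multi_index N) x z : R :=
  \prod_(i < l) ('C(N i, J i)%:R *
    ((z 0 i - lo x i) ^+ J i * (hi x i - z 0 i) ^+ (N i - J i)
       / (hi x i - lo x i) ^+ N i)).

Definition patch_type p : Type := {ffun multi_index (multidegree p) -> R}.

Definition is_patch p x (B : patch_type p) : Prop :=
  forall z, peval p z = \sum_J B J * bernstein_basis J x z.

(* The unique array of coefficients expanding p in the Bernstein basis over x;
   the default value [ffun=> 0] is irrelevant since the expansion exists. *)
Definition patch p x : patch_type p :=
  xget ([ffun=> 0] : patch_type p) [set B : patch_type p | is_patch x B].

(* The entry at multi_index0 is itself one of the entries, so that it is a
   neutral starting value. *)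
Definition patch_min p x : R :=
  \big[Num.min/patch p x (multi_index0 _)]_J patch p x J.

Definition patch_max p x : R :=
  \big[Num.max/patch p x (multi_index0 _)]_J patch p x J.

End Bernstein.

Section PCBA.
Context {R : realType} {l : nat}.
Implicit Types (p : mpoly l R) (x : box R l) (L : seq (box R l)).

Definition p_up p L : \bar R :=
  \big[Order.min/+oo%E]_(x <- L) (patch_max p x)%:E.

Definition suboptimal p L x : bool := (p_up p L < (patch_min p x)%:E)%E.

Definition cut_off p L : seq (box R l) := [seq x <- L | ~~ suboptimal p L x].

Definition pcba_iteration p L : seq (box R l) :=
  foldl (fun L' r => cut_off p (bisect r L')) L (enum 'I_l).

Definition pcba_list p (n : nat) : seq (box R l) :=
  iter n (pcba_iteration p) [:: unit_box].

Definition stopping_criterion p (eps delta : R) L : Prop :=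
  exists x, [/\ x \in L, box_width x <= delta &
    forall y, y \in L -> patch_max p x - patch_min p y <= eps].

Definition pcba_iterations_needed p (eps delta : R) (n : nat) : Prop :=
  stopping_criterion p eps delta (pcba_list p n) /\
  forall k, (k < n)%N -> ~ stopping_criterion p eps delta (pcba_list p k).

End PCBA.

Section Problem.
Context {R : realType} {l : nat}.
Implicit Types (p : mpoly l R) (z : 'rV[R]_l).

Definition global_minimizer p (A : set 'rV[R]_l) z : Prop :=
  A z /\ forall y, A y -> peval p z <= peval p y.

Definition boundary (A : set 'rV[R]_l) : set 'rV[R]_l := closure A `\` A°.

Definition hessian p z : 'M[R]_l :=
  \matrix_(i, j) peval (mderiv i (mderiv j p)) z.

Definition posdefmx (A : 'M[R]_l) : Prop :=
  A^T = A /\ forall v : 'cV[R]_l, v != 0 -> 0 < (v^T *m A *m v) 0 0.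

Definition log2 (a : R) : R := ln a / ln 2.

End Problem.

(* Main.v *)
Require Import Defs.
From mathcomp Require Import all_boot all_order all_algebra.
From mathcomp Require Import all_classical all_reals all_analysis.
From mathcomp Require Import -(notations) mpoly.
From mathcomp Require Import ring lra zify.

(** Let xs be an interior global minimizer, so that the gradient of p vanishes
    at xs.  The theorem follows from a bound on all Bernstein coefficients: over
    a box contained in the unit box and of widths at most w,

    - every entry of the patch is at least p(xs) - C w^2, and
    - if the box contains xs, every entry is at most p(xs) + C w^2,

    with C depending only on p (patch_near_minimum).  After n iterations all
    boxes have width 2^-n, and some box x containing xs is still in the list:
    min B(x) <= p(xs) <= max B(y) for every box y of the list, so x always passes
    the cut-off test (tracks_pcba_list).  Hence max B(x) - min B(y) <= 2 C 4^-n
    for all y in the list, and the stopping criterion holds as soon as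
    2^-n <= delta and 2 C 4^-n <= eps (stopping_criterion_met).

    The bound on the coefficients is a first-order Taylor estimate.  A Bernstein
    coefficient is a linear functional of p that acts on products of univariate
    polynomials as the product of the univariate coefficient functionals; so it
    is determined by its moments, the values mu i k of the i-th functional at
    (t - c_i)^k for a centre c of our choice (patch_momentE).  For c in the box,
    mu i 0 = 1 and |mu i k| <= w^k (moments_within_bernstein).  Any functional
    with such moments takes at p the value
    p(c) + \sum_i D_i(c) mu i 1 + O(w^2), uniformly in c
    (moment_value_expansion).  Evaluation at a point z is also such a functional,
    with moments (z_i - c_i)^k, and comparing p at xs with p at nearby points
    gives D(xs) = 0 (critical_point).  Two choices of c now give the two bounds.
    When c is the grid point to which the coefficient belongs, mu i 1 = 0, so the
    coefficient is p(c) + O(w^2) with p(c) >= p(xs).  When c = xs, the linear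
    part vanishes because D(xs) = 0. *)

Set Implicit Arguments.
Unset Strict Implicit.
Unset Printing Implicit Defensive.
Import Order.TTheory GRing.Theory Num.Theory.
Import numFieldNormedType.Exports.
Local Open Scope ring_scope.

Local Notation patch := Defs.patch.

(** * Distributivity over dependent finite functions *)

(** The multi-indices J <= N form a dependent function type, as the range of the
    i-th index depends on i; this law makes the multivariate Bernstein basis a
    tensor product of univariate ones. *)
Lemma prod_sum_dffun (R : comPzSemiRingType) (I : finType) (T_ : I -> finType)
    (F : forall i, T_ i -> R) :
  \prod_i \sum_j F i j = \sum_(t : {dffun forall i, T_ i}) \prod_i F i (t i).
Proof.
rewrite (reindex (@dffun_of_fprod I T_)); last exact/onW_bij/dffun_of_fprod_bij.
pose P_ i : {ffun T_ i -> R} := [ffun j => F i j].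
transitivity (\prod_i \sum_j P_ i j).
  by apply: eq_bigr => i _; apply: eq_bigr => j _; rewrite ffunE.
transitivity (\sum_(t : fprod T_) \prod_i P_ i (t i)); last first.
  by apply: eq_bigr => t _; apply: eq_bigr => i _; rewrite !ffunE.
rewrite [RHS](big_fprod 1 _ P_) -(bigA_distr_big_dep (fun i => tagged_with T_ i)
  (fun i => untag 0 (P_ i))).
by apply: eq_bigr => i _; rewrite (big_tag (fun i => P_ i)).
Qed.

(** * Univariate Bernstein expansions *)

Section Univariate.
Variable R : realType.
Implicit Types (a b c t u v w : R) (n d j k : nat).

Definition bern n j a b t : R :=
  'C(n, j)%:R * ((t - a) ^+ j * (b - t) ^+ (n - j) / (b - a) ^+ n).

(** The j-th Bernstein coefficient, in degree n = d + k, of (u s + v q)^k where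
    s + q = 1.  Multiplying by u s + v q raises the degree by one and replaces
    the coefficients by averages of neighbouring ones weighted by u and v. *)
Fixpoint bcoef d u v k j : R :=
  if k is k'.+1 then
    (u * j%:R * bcoef d u v k' j.-1 +
     v * (d + k - j)%:R * bcoef d u v k' j) / (d + k)%:R
  else 1.

(** The homogeneous form, valid for all s and q: the factor (s + q)^d is what
    raises the degree from k to d + k. *)
Lemma bcoef_sum d u v k s q :
  \sum_(j < (d + k).+1)
     bcoef d u v k j * ('C(d + k, j)%:R * (s ^+ j * q ^+ (d + k - j)))
  = (u * s + v * q) ^+ k * (s + q) ^+ d.
Proof.
elim: k => [|k IHk].
  rewrite addn0 expr0 mul1r addrC exprDn; apply: eq_bigr => j _.
  by rewrite mul1r mulr_natl [q ^+ _ * _]mulrC.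
rewrite exprS -mulrA -{}IHk addnS; set n := (d + k)%N.
rewrite mulrDl !big_distrr /=.
pose e j := bcoef d u v k j * 'C(n, j)%:R.
have eqB j : (n.+1 - j)%:R * 'C(n.+1, j)%:R = n.+1%:R * 'C(n, j)%:R :> R.
  by rewrite -!natrM -(mul_bin_down n.+1).
have eqD j : j.+1%:R * 'C(n.+1, j.+1)%:R = n.+1%:R * 'C(n, j)%:R :> R.
  by rewrite -!natrM -(mul_bin_diag n.+1).
have n0 : n.+1%:R != 0 :> R by rewrite pnatr_eq0.
transitivity (\sum_(j < n.+2) (j%:R * (u * bcoef d u v k j.-1 * 'C(n.+1, j)%:R) / n.+1%:R
    * (s ^+ j * q ^+ (n.+1 - j)))
  + \sum_(j < n.+2) (v * e j * (s ^+ j * q ^+ (n.+1 - j)))).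
  rewrite -big_split /=; apply: eq_bigr => j _.
  rewrite /e addnS -/n [RHS]addrC -[in 'C(n, j)%:R](mulKf n0 'C(n, j)%:R) -eqB.
  by field.
congr (_ + _).
  rewrite big_ord_recl /= !mul0r add0r; apply: eq_bigr => j _.
  rewrite /bump /= !add1n add0n [_.+1%:R * (_ * _)]mulrCA eqD subSS exprS.
  by field.
rewrite big_ord_recr /= /e bin_small // !(mulr0, mul0r) addr0.
apply: eq_bigr => j _; rewrite subSn; last by rewrite -ltnS.
by rewrite exprS; ring.
Qed.

(** Each step of the recursion is u or v times a weighted average, with weights
    j / n and (n - j) / n, and so multiplies the bound by at most w. *)
Lemma bcoef_le d u v w k j : `|u| <= w -> `|v| <= w -> (j <= d + k)%N ->
  `|bcoef d u v k j| <= w ^+ k.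
Proof.
move=> uw vw; have w0 : 0 <= w by apply: le_trans uw.
elim: k j => [|k IHk] j le_j; first by rewrite normr1.
have dk : 0 < (d + k.+1)%:R :> R by rewrite ltr0n addnS.
rewrite /= normrM normfV [`|_%:R|]gtr0_norm // ler_pdivrMr //.
have -> : w ^+ k.+1 * (d + k.+1)%:R = w * j%:R * w ^+ k + w * (d + k.+1 - j)%:R * w ^+ k.
  by rewrite -[in LHS](subnKC le_j) natrD exprS; ring.
apply: le_trans (ler_normD _ _) _; apply: lerD; rewrite !normrM normr_nat.
  case: j le_j => [|j] le_j; first by rewrite !(mulr0, mul0r).
  apply: ler_pM; rewrite ?mulr_ge0 //.
    by rewrite ler_pM.
  by apply: IHk; rewrite -ltnS -addnS.
have [->|ne_j] := eqVneq j (d + k.+1)%N; first by rewrite subnn !(mulr0, mul0r).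
apply: ler_pM; rewrite ?mulr_ge0 //.
  by rewrite ler_pM.
by apply: IHk; lia.
Qed.

(** On [a, b] take s = (t - a) / (b - a) and q = (b - t) / (b - a); then
    s + q = 1 and t - c = (b - c) s + (a - c) q. *)
Lemma bern_sum_pow n k a b c t : a < b -> (k <= n)%N ->
  (t - c) ^+ k = \sum_(j < n.+1) bcoef (n - k) (b - c) (a - c) k j * bern n j a b t.
Proof.
move=> ab kn; have ba : b - a != 0 by rewrite subr_eq0 gt_eqF.
have := bcoef_sum (n - k) (b - c) (a - c) k ((t - a) / (b - a)) ((b - t) / (b - a)).
rewrite subnK // => E.
have -> : (t - c) = (b - c) * ((t - a) / (b - a)) + (a - c) * ((b - t) / (b - a)) by field.
transitivity (((b - c) * ((t - a) / (b - a)) + (a - c) * ((b - t) / (b - a))) ^+ k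
  * ((t - a) / (b - a) + (b - t) / (b - a)) ^+ (n - k)).
  suff -> : (t - a) / (b - a) + (b - t) / (b - a) = 1 by rewrite expr1n mulr1.
  by field.
rewrite -E; apply: eq_bigr => j _; rewrite /bern !expr_div_n.
have -> : (b - a) ^+ n = (b - a) ^+ j * (b - a) ^+ (n - j).
  by rewrite -exprD subnKC // -ltnS.
by field; rewrite !expf_neq0.
Qed.

Lemma bern_ge0 n j a b t : a <= t <= b -> 0 <= bern n j a b t.
Proof.
move=> /andP[at_ tb]; have ab := le_trans at_ tb.
by rewrite mulr_ge0 ?divr_ge0 ?mulr_ge0 ?exprn_ge0 ?subr_ge0.
Qed.

(** In the variable s = (t - a) / (b - t) the basis becomes
    'C(n, j) s^j / (1 + s)^n, so sampling at s = 0, 1, ..., n gives a rescaled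
    Vandermonde matrix, whose inverse provides the dual basis.  The functionals
    are combinations of point evaluations, hence apply to arbitrary functions. *)
Lemma bern_dual n a b : a < b -> exists (alpha : 'I_n.+1 -> 'I_n.+1 -> R)
    (node : 'I_n.+1 -> R), forall i j : 'I_n.+1,
  \sum_k alpha i k * bern n j a b (node k) = (j == i)%:R.
Proof.
move=> ab; have ba : b - a != 0 by rewrite subr_eq0 gt_eqF.
pose V : 'M[R]_n.+1 := Vandermonde n.+1 (\row_k (k : nat)%:R).
have V_unit : V \in unitmx.
  rewrite unitmxE unitfE det_Vandermonde; apply/prodf_neq0 => i _.
  apply/prodf_neq0 => j ij; rewrite !mxE subr_eq0 eqr_nat.
  by rewrite gtn_eqF.
have k0 (k : 'I_n.+1) : 1 + (k : nat)%:R != 0 :> R by rewrite nat1r pnatr_eq0.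
exists (fun i k : 'I_n.+1 => invmx V k i * (1 + (k : nat)%:R) ^+ n / 'C(n, i)%:R).
(* The node t solves (t - a) / (b - t) = k. *)
exists (fun k : 'I_n.+1 => (a + b * (k : nat)%:R) / (1 + (k : nat)%:R)) => i j.
have C0 (l : 'I_n.+1) : 'C(n, l)%:R != 0 :> R.
  by rewrite pnatr_eq0 -lt0n bin_gt0 -ltnS.
transitivity ((V *m invmx V) j i * ('C(n, j)%:R / 'C(n, i)%:R)).
  rewrite mxE big_distrl; apply: eq_bigr => k _ /=.
  rewrite /bern; set x : R := (k : nat)%:R.
  have -> : (a + b * x) / (1 + x) - a = (b - a) * x / (1 + x) by field.
  have -> : b - (a + b * x) / (1 + x) = (b - a) / (1 + x) by field.
  rewrite [V j k]mxE mxE -/x !expr_div_n exprMn.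
  have splitX (y : R) : y ^+ n = y ^+ j * y ^+ (n - j).
    by rewrite -exprD subnKC // -ltnS.
  have x0 : 1 + x != 0 := k0 k.
  by rewrite !splitX; field; rewrite C0 !expf_neq0.
rewrite mulmxV // mxE; case: eqVneq => [->|_]; last by rewrite mul0r.
by rewrite divff // mulr1.
Qed.

End Univariate.

(** * Bernstein coefficients in terms of moments *)

Section MomentValue.
Variables (R : realType) (l : nat).
Implicit Types (p : mpoly l R) (c z : 'rV[R]_l) (mu : 'I_l -> nat -> R).

(** The value at t^m of a linear functional whose value at (t - c)^k is mu k. *)
Definition shifted_pow (c : R) (mu : nat -> R) m : R :=
  \sum_(k < m.+1) (c ^+ (m - k) * mu k) *+ 'C(m, k).

(** The value at p of the tensor product of univariate functionals, the i-th of
    which has the moments mu i about c i. *)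
Definition moment_value p c mu : R :=
  \sum_(m <- msupp p) mcoeff m p *
    \prod_i shifted_pow (c 0 i) (mu i) ((m : multinom l) i).

Lemma moment_value_point p c z :
  moment_value p c (fun i k => (z 0 i - c 0 i) ^+ k) = peval p z.
Proof.
rewrite /peval mevalE; apply: eq_bigr => m _; congr (_ * _).
apply: eq_bigr => i _; rewrite -[in RHS](subrK (c 0 i) (z 0 i)) [_ + c 0 i]addrC.
by rewrite exprDn.
Qed.

End MomentValue.

Section Patch.
Variables (R : realType) (l : nat) (p : mpoly l R) (x : box R l).
Local Notation N := (multidegree p).
Implicit Types (c z : 'rV[R]_l) (J K : multi_index N).

(** The coefficient of index J i of (t - c i)^k in degree N i.  Only k <= N i
    makes sense and occurs in the expansion of p; the value 0 beyond keeps the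
    bound |mu i k| <= w^k for all k. *)
Definition bernstein_moment J c (i : 'I_l) (k : nat) : R :=
  if (k <= N i)%N
  then bcoef (N i - k) (hi x i - c 0 i) (lo x i - c 0 i) k (J i) else 0.

Lemma multidegreeP (m : multinom l) (i : 'I_l) : m \in msupp p -> (m i <= N i)%N.
Proof.
move=> mp; rewrite /multidegree.
exact: (@leq_bigmax_seq _ _ xpredT (fun m : multinom l => m i)).
Qed.

Lemma bernstein_basisE J z :
  bernstein_basis J x z = \prod_i bern (N i) (J i) (lo x i) (hi x i) (z 0 i).
Proof. by []. Qed.

Lemma is_patch_moment c :
  is_patch x ([ffun J => moment_value p c (bernstein_moment J c)] : patch_type p).
Proof.
move=> z; rewrite /peval mevalE.
under [RHS]eq_bigr do rewrite ffunE /moment_value big_distrl /=.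
rewrite exchange_big /= big_seq [RHS]big_seq; apply: eq_bigr => m mp.
under [RHS]eq_bigr do rewrite -mulrA bernstein_basisE -big_split /=.
rewrite -big_distrr /=; congr (_ * _).
rewrite -(prod_sum_dffun (fun i (j : 'I_(N i).+1) => shifted_pow (c 0 i)
  (fun k => if (k <= N i)%N then
     bcoef (N i - k) (hi x i - c 0 i) (lo x i - c 0 i) k j else 0) (m i)
  * bern (N i) j (lo x i) (hi x i) (z 0 i))).
apply: eq_bigr => i _; have mN := multidegreeP i mp.
rewrite -[in LHS](subrK (c 0 i) (z 0 i)) [_ + c 0 i]addrC exprDn.
under [RHS]eq_bigr do rewrite /shifted_pow big_distrl /=.
rewrite exchange_big /=; apply: eq_bigr => k _.
have kN : (k <= N i)%N by rewrite (leq_trans _ mN) // -ltnS.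
rewrite (bern_sum_pow (c 0 i) (z 0 i) (lo_lt_hi x i) kN) big_distrr /= -sumrMnl.
by apply: eq_bigr => j _; rewrite kN mulrnAl mulrA.
Qed.

(** The tensor product of the univariate dual functionals reads off the
    coefficient of index J from the function alone. *)
Lemma bernstein_dual J : exists lam : ('rV[R]_l -> R) -> R,
  forall B : patch_type p, lam (fun z => \sum_K B K * bernstein_basis K x z) = B J.
Proof.
have ex_dual (i : 'I_l) : exists d :
    ('I_(N i).+1 -> 'I_(N i).+1 -> R) * ('I_(N i).+1 -> R), forall j k : 'I_(N i).+1,
    \sum_q d.1 j q * bern (N i) k (lo x i) (hi x i) (d.2 q) = (k == j)%:R.
  by have [al [nd H]] := bern_dual (N i) (lo_lt_hi x i); exists (al, nd).
pose dual i := projT1 (cid (ex_dual i)).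
have dualP i := projT2 (cid (ex_dual i)) : forall j k : 'I_(N i).+1,
    \sum_q (dual i).1 j q * bern (N i) k (lo x i) (hi x i) ((dual i).2 q) = (k == j)%:R.
exists (fun f => \sum_(K : multi_index N) (\prod_i (dual i).1 (J i) (K i)) *
                   f (\row_i (dual i).2 (K i))) => B.
under eq_bigr do rewrite big_distrr /=.
rewrite exchange_big /= (bigD1 J) //= [X in _ + X]big1 ?addr0 => [|K KJ];
  under eq_bigr do [rewrite mulrCA bernstein_basisE -big_split /=;
    under eq_bigr do rewrite mxE];
  rewrite -big_distrr -(prod_sum_dffun (fun i q => (dual i).1 (J i) q *
    bern (N i) _ (lo x i) (hi x i) ((dual i).2 q))) /=.
  by rewrite big1 ?mulr1 // => i _; rewrite dualP eqxx.
have [i KJi] : exists i, K i != J i.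
  apply/existsP; apply: contra_neqT KJ => /existsPn KJ.
  by apply/ffunP => i; apply/eqP; rewrite -[_ == _]negbK KJ.
by rewrite (bigD1 i) //= dualP (negPf KJi) mul0r mulr0.
Qed.

Lemma is_patch_uniq (B B' : patch_type p) : is_patch x B -> is_patch x B' -> B = B'.
Proof.
move=> BP B'P; apply/ffunP => J; have [lam lamE] := bernstein_dual J.
by rewrite -!lamE; congr lam; apply/funext => z; rewrite -BP -B'P.
Qed.

Lemma patchP : is_patch x (patch p x).
Proof.
apply: (@xgetPex _ _ [set B | is_patch x B]).
by eexists; exact: (is_patch_moment 0).
Qed.

(** The patch is defined by choice; uniqueness of the expansion identifies it
    with the array of moment values about every centre c at once. *)
Lemma patch_momentE c J : patch p x J = moment_value p c (bernstein_moment J c).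
Proof. by rewrite (is_patch_uniq patchP (is_patch_moment c)) ffunE. Qed.

Lemma bernstein_basis_ge0 J z : box_set x z -> 0 <= bernstein_basis J x z.
Proof. by move=> xz; apply: prodr_ge0 => i _; apply: bern_ge0. Qed.

Lemma bernstein_basis_sum z : \sum_(J : multi_index N) bernstein_basis J x z = 1.
Proof.
rewrite -(prod_sum_dffun (fun i (j : 'I_(N i).+1) =>
  bern (N i) j (lo x i) (hi x i) (z 0 i))) big1 // => i _.
have := bern_sum_pow 0 (z 0 i) (lo_lt_hi x i) (leq0n (N i)).
by rewrite expr0 => ->; apply: eq_bigr => j _; rewrite mul1r.
Qed.

Lemma patch_min_le J : patch_min p x <= patch p x J.
Proof. exact: bigmin_le. Qed.

Lemma le_patch_max J : patch p x J <= patch_max p x.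
Proof. exact: le_bigmax. Qed.

Lemma patch_min_le_peval z : box_set x z -> patch_min p x <= peval p z.
Proof.
move=> xz; rewrite patchP -[leLHS]mulr1 -(bernstein_basis_sum z) big_distrr /=.
by apply: ler_sum => J _; rewrite ler_wpM2r ?bernstein_basis_ge0 ?patch_min_le.
Qed.

Lemma peval_le_patch_max z : box_set x z -> peval p z <= patch_max p x.
Proof.
move=> xz; rewrite patchP -[leRHS]mulr1 -(bernstein_basis_sum z) big_distrr /=.
by apply: ler_sum => J _; rewrite ler_wpM2r ?bernstein_basis_ge0 ?le_patch_max.
Qed.

End Patch.

(** * First-order expansion with a quadratic remainder *)

Section FirstOrder.
Variables (R : realType) (l : nat).
Implicit Types (c z : 'rV[R]_l) (mu : 'I_l -> nat -> R) (w : R).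
Implicit Types A : 'rV[R]_l -> ('I_l -> nat -> R) -> R.

(** Shared by evaluation at a point within distance w of the centre and by the
    Bernstein functionals of a box of widths at most w that contains the
    centre. *)
Definition moments_within w mu : Prop :=
  forall i, mu i 0%N = 1 /\ forall k, `|mu i k| <= w ^+ k.

(** The constant C is uniform in the centre c.  The bounds on A0 and D are part
    of the property to make it stable under products. *)
Definition first_order_expandable A : Prop :=
  exists (C : R) (A0 : 'rV[R]_l -> R) (D : 'rV[R]_l -> 'I_l -> R),
  forall c mu w, box_set unit_box c -> 0 <= w <= 1 -> moments_within w mu ->
  [/\ `|A0 c| <= C, forall i, `|D c i| <= C &
      `|A c mu - A0 c - \sum_i D c i * mu i 1%N| <= C * w ^+ 2].

Lemma unit_boxP c : box_set unit_box c <-> forall i, 0 <= c 0 i <= 1.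
Proof. by split=> H i; have := H i; rewrite /lo /hi /= !mxE. Qed.

Lemma linear_part_le (D : 'I_l -> R) (C w : R) mu : moments_within w mu -> 0 <= w ->
  (forall i, `|D i| <= C) -> `|\sum_i D i * mu i 1%N| <= l%:R * C * w.
Proof.
move=> mu_w w0 DC; apply: le_trans (ler_norm_sum _ _ _) _.
rewrite -mulrA mulr_natl -[X in _ *+ X](card_ord l) -sumr_const.
apply: ler_sum => i _; rewrite normrM ler_pM //.
by have := (mu_w i).2 1%N; rewrite expr1.
Qed.

Lemma expandable_cst (a : R) : first_order_expandable (fun _ _ => a).
Proof.
exists `|a|, (fun=> a), (fun _ _ => 0) => c mu w _ _ _; split => // [i|].
  by rewrite normr0.
rewrite subrr big1 => [|i _]; last by rewrite mul0r.
by rewrite subrr normr0 mulr_ge0 ?sqr_ge0.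
Qed.

Lemma expandableD A A' : first_order_expandable A -> first_order_expandable A' ->
  first_order_expandable (fun c mu => A c mu + A' c mu).
Proof.
move=> [C [A0 [D H]]] [C' [A0' [D' H']]].
exists (C + C'), (fun c => A0 c + A0' c), (fun c i => D c i + D' c i) => c mu w cu w01 mu_w.
have [h1 h2 h3] := H c mu w cu w01 mu_w; have [h1' h2' h3'] := H' c mu w cu w01 mu_w.
split=> [|i|]; try by rewrite (le_trans (ler_normD _ _)) // lerD.
under eq_bigr do rewrite mulrDl.
rewrite big_split /= mulrDl; apply: le_trans (lerD h3 h3').
apply: le_trans (ler_normD _ _); rewrite le_eqVlt; apply/orP; left.
by apply/eqP; congr `|_|; ring.
Qed.

(** With A = A0 + L + e and A' = A0' + L' + e', the terms of the product that
    are not of order at most one are L L', e A' and (A0 + L) e'.  They are O(w^2)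
    because |L| <= l C w, |L'| <= l C' w, |e| <= C w^2 and |e'| <= C' w^2. *)
Lemma expandableM A A' : first_order_expandable A -> first_order_expandable A' ->
  first_order_expandable (fun c mu => A c mu * A' c mu).
Proof.
move=> [C [A0 [D H]]] [C' [A0' [D' H']]].
exists ((l%:R + 2) ^+ 2 * (C * C')), (fun c => A0 c * A0' c),
  (fun c i => A0 c * D' c i + A0' c * D c i) => c mu w cu w01 mu_w.
have [h1 h2 h3] := H c mu w cu w01 mu_w; have [h1' h2' h3'] := H' c mu w cu w01 mu_w.
have /andP[w0 w1] := w01.
have C0 : 0 <= C by apply: le_trans h1.
have C0' : 0 <= C' by apply: le_trans h1'.
have CC : 0 <= C * C' by rewrite mulr_ge0.
have n0 : 0 <= l%:R :> R by [].
split=> [|i|].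
- rewrite normrM (le_trans (ler_pM _ _ h1 h1')) // -[leLHS]mul1r; apply: ler_wpM2r => //.
  by nra.
- rewrite (le_trans (ler_normD _ _)) // !normrM.
  rewrite (le_trans (lerD (ler_pM _ _ h1 (h2' i)) (ler_pM _ _ h1' (h2 i)))) //.
  rewrite (_ : C * C' + C' * C = 2 * (C * C')); last by ring.
  by apply: ler_wpM2r => //; nra.
have := linear_part_le mu_w w0 h2; have := linear_part_le mu_w w0 h2'.
under [X in `|_ - X|]eq_bigr do rewrite mulrDl -!mulrA.
rewrite big_split -!big_distrr /=.
set L := \sum_i D c i * _; set L' := \sum_i D' c i * _ => hL' hL.
set e := A c mu - A0 c - L in h3; set e' := A' c mu - A0' c - L' in h3'.
have -> : A c mu * A' c mu - A0 c * A0' c - (A0 c * L' + A0' c * L) =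
    L * L' + (e * (A0' c + L' + e') + (A0 c + L) * e') by rewrite /e /e'; ring.
have lC : 0 <= l%:R * C * w by rewrite !mulr_ge0.
have lC' : 0 <= l%:R * C' * w by rewrite !mulr_ge0.
have lw (K : R) : 0 <= K -> l%:R * K * w <= l%:R * K.
  by move=> K0; rewrite -[leRHS]mulr1 ler_wpM2l // mulr_ge0.
have h4 : `|A0' c + L' + e'| <= (l%:R + 2) * C'.
  apply: le_trans (ler_normD _ _) _; have := ler_normD (A0' c) L'.
  have := lw _ C0'; have : C' * w ^+ 2 <= C' by rewrite -[leRHS]mulr1 ler_wpM2l // exprn_ile1.
  by lra.
have h5 : `|A0 c + L| <= (l%:R + 1) * C.
  by have := ler_normD (A0 c) L; have := lw _ C0; lra.
apply: le_trans (ler_normD _ _) _.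
apply: le_trans (lerD _ (ler_normD _ _)) _; first by rewrite normrM; exact: ler_pM hL hL'.
rewrite !normrM.
apply: le_trans (lerD (lexx _) (lerD (ler_pM _ _ h3 h4) (ler_pM _ _ h5 h3'))) _ => //.
have : 0 <= C * C' * w ^+ 2 by rewrite mulr_ge0 // exprn_ge0.
by move: n0; move: (l%:R : R) => n n0; nra.
Qed.

(** The terms k >= 2 of the binomial expansion are at most 'C(m, k) w^2, because
    c lies in [0, 1] and w <= 1; their sum is at most 2^m w^2. *)
Lemma expandable_shifted_pow (i : 'I_l) m :
  first_order_expandable (fun c mu => shifted_pow (c 0 i) (mu i) m).
Proof.
exists (2 ^+ m), (fun c => c 0 i ^+ m),
  (fun c j => if j == i then m%:R * c 0 i ^+ m.-1 else 0) => c mu w cu w01 mu_w.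
have /andP[w0 w1] := w01; have /andP[c0 c1] := (unit_boxP c).1 cu i.
have cX k : `|c 0 i ^+ k| <= 1 by rewrite ger0_norm ?exprn_ge0 // exprn_ile1.
split=> [|j|].
- by rewrite (le_trans (cX _)) // exprn_ege1 // ler1n.
- case: eqP => _; last by rewrite normr0 exprn_ge0.
  rewrite normrM normr_nat -[leRHS]mulr1 ler_pM //.
  by rewrite -natrX ler_nat ltnW // ltn_expl.
rewrite (bigD1 i) //= eqxx [\sum_(j | _) _]big1 ?addr0 => [|j /negPf->];
  last by rewrite mul0r.
rewrite /shifted_pow; have [mu0 muk] := mu_w i.
case: m => [|m].
  by rewrite big_ord1 mu0 mulr1 !mul0r subr0 subrr normr0 mulr_ge0 ?exprn_ge0.
rewrite big_ord_recl big_ord_recl /= mu0 bin0 mulr1 subn0.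
rewrite /bump /= add1n bin1 subn1 /= mulr1n -mulr_natl mulrA.
rewrite [X in `|X|](_ : _ = \sum_(k < m) (c 0 i ^+ (m.+1 - k.+2) * mu i k.+2) *+ 'C(m.+1, k.+2)).
  have -> : 2 ^+ m.+1 = \sum_(k < m.+2) 'C(m.+1, k)%:R :> R.
    by have := exprDn 1 1 m.+1 => ->; apply: eq_bigr => k _; rewrite !expr1n mulr1.
  (* The terms k = 0 and k = 1 of this sum are dropped: they are nonnegative. *)
  rewrite big_ord_recl big_ord_recl mulrDl mulrDl addrA.
  rewrite (le_trans (ler_norm_sum _ _ _)) // big_distrl /= -[leLHS]add0r.
  rewrite lerD ?addr_ge0 ?mulr_ge0 ?exprn_ge0 //.
  apply: ler_sum => k _; rewrite /bump /= !add1n normrMn mulr_natl ler_wMn2r //.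
  rewrite normrM -[leRHS]mul1r ler_pM // (le_trans (muk _)) //.
  by rewrite ler_wiXn2l.
have cancel_terms (x y s : R) : x + (y + s) - x - y = s by ring.
exact: cancel_terms.
Qed.

Lemma expandable_sum (I : Type) (r : seq I) (A : I -> _) :
  (forall i, first_order_expandable (A i)) ->
  first_order_expandable (fun c mu => \sum_(i <- r) A i c mu).
Proof.
move=> HA; elim: r => [|i r IHr].
  have := expandable_cst 0; congr first_order_expandable.
  by apply/funext => c; apply/funext => mu; rewrite big_nil.
have := expandableD (HA i) IHr; congr first_order_expandable.
by apply/funext => c; apply/funext => mu; rewrite big_cons.
Qed.

Lemma expandable_prod (I : Type) (r : seq I) (A : I -> _) :
  (forall i, first_order_expandable (A i)) ->
  first_order_expandable (fun c mu => \prod_(i <- r) A i c mu).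
Proof.
move=> HA; elim: r => [|i r IHr].
  have := expandable_cst 1; congr first_order_expandable.
  by apply/funext => c; apply/funext => mu; rewrite big_nil.
have := expandableM (HA i) IHr; congr first_order_expandable.
by apply/funext => c; apply/funext => mu; rewrite big_cons.
Qed.

Lemma expandable_moment_value (p : mpoly l R) :
  first_order_expandable (moment_value p).
Proof.
apply: expandable_sum => m; apply: expandableM; first exact: expandable_cst.
by apply: expandable_prod => i; apply: expandable_shifted_pow.
Qed.

Lemma moments_within_point w c z : (forall i, `|z 0 i - c 0 i| <= w) ->
  moments_within w (fun i k => (z 0 i - c 0 i) ^+ k).
Proof.
move=> zc i; split=> [|k]; rewrite ?expr0 // normrX lerXn2r // nnegrE.
by rewrite (le_trans _ (zc i)).
Qed.

(** The constant term is p(c): evaluation at c itself has moments bounded by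
    w^k with w = 0, so its remainder vanishes. *)
Lemma moment_value_expansion (p : mpoly l R) :
  exists (C : R) (D : 'rV[R]_l -> 'I_l -> R), 0 <= C /\
  forall c mu w, box_set unit_box c -> 0 <= w <= 1 -> moments_within w mu ->
  `|moment_value p c mu - peval p c - \sum_i D c i * mu i 1%N| <= C * w ^+ 2.
Proof.
have [C [A0 [D H]]] := expandable_moment_value p.
have pA0 c : box_set unit_box c -> peval p c = A0 c.
  move=> cu; have mc : moments_within 0 (fun i k => (c 0 i - c 0 i) ^+ k).
    by apply: moments_within_point => i; rewrite subrr normr0.
  have [|_ _] := H c _ 0 cu _ mc; first by rewrite lexx ler01.
  rewrite moment_value_point expr0n mulr0 normr_le0 big1 => [|i _].
    by rewrite subr0 subr_eq0 => /eqP.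
  by rewrite subrr expr1 mulr0.
exists `|C|, D; split=> // c mu w cu w01 mu_w; have [_ _] := H c mu w cu w01 mu_w.
rewrite pA0 // => /le_trans; apply.
by rewrite ler_wpM2r ?ler_norm // exprn_ge0 //; case/andP: w01.
Qed.

End FirstOrder.

(** * Bernstein coefficients near an interior minimizer *)

Section PatchBounds.
Variables (R : realType) (l : nat) (p : mpoly l R).
Implicit Types (x y : box R l) (c z xs : 'rV[R]_l).
Local Notation N := (multidegree p).

(** If N i = 0 the quotient is 0 / 0 = 0 and the coordinate is lo x i. *)
Definition grid_point x (J : multi_index N) : 'rV[R]_l :=
  \row_i (lo x i + (J i)%:R / (N i)%:R * (hi x i - lo x i)).

Lemma grid_point_in x J : box_set x (grid_point x J).
Proof.
move=> i; rewrite mxE; have lh := lo_lt_hi x i.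
have /andP[t0 t1] : 0 <= ((J i)%:R / (N i)%:R : R) <= 1.
  have JN : (J i <= N i)%N by rewrite -ltnS.
  rewrite divr_ge0 //=; move: (nat_of_ord (J i)) JN => j; case: (N i) => [|n] jn.
    by rewrite invr0 mulr0 ler01.
  by rewrite ler_pdivrMr ?mul1r ?ler_nat.
by move: (_ / _) t0 t1 => t t0 t1; apply/andP; split; nra.
Qed.

(** Bernstein coefficients of degree-one polynomials are their values at the
    grid points. *)
Lemma bernstein_moment_grid x J i : bernstein_moment x J (grid_point x J) i 1 = 0.
Proof.
rewrite /bernstein_moment lt0n; case: eqP => //= /eqP N0; rewrite mxE !mulr1.
rewrite subnK ?lt0n // natrB; last by rewrite -ltnS.
by field; rewrite pnatr_eq0.
Qed.

Lemma moments_within_bernstein (w : R) x (J : multi_index N) c : box_set x c ->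
  (forall i, hi x i - lo x i <= w) -> moments_within w (bernstein_moment x J c).
Proof.
move=> xc xw i; have /andP[loc chi] := xc i; have xwi := xw i.
rewrite /bernstein_moment; split=> // k.
have w0 : 0 <= w by lra.
case: leqP => kN; last by rewrite normr0 exprn_ge0.
apply: bcoef_le; last by rewrite subnK // -ltnS.
  by rewrite ger0_norm; lra.
by rewrite ler0_norm; lra.
Qed.

(** Moving from xs by t along the i-th axis changes p by D_i t + O(t^2), which
    can only be nonnegative for both signs of t if D_i = 0. *)
Lemma critical_point (C : R) (D : 'I_l -> R) xs (r : R) :
  (forall mu w, 0 <= w <= 1 -> moments_within w mu ->
    `|moment_value p xs mu - peval p xs - \sum_i D i * mu i 1%N| <= C * w ^+ 2) ->
  0 < r ->
  (forall z, (forall i, `|z 0 i - xs 0 i| < r) -> peval p xs <= peval p z) ->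
  forall i, D i = 0.
Proof.
move=> H r0 minxs i.
have step s t : 0 < s -> s < r -> s <= 1 -> `|t| = s -> - (D i * t) <= C * s ^+ 2.
  move=> s0 sr s1 ts; pose z : 'rV[R]_l := \row_j (xs 0 j + (if j == i then t else 0)).
  have zE j : z 0 j - xs 0 j = if j == i then t else 0 by rewrite mxE addrC addKr.
  have zs j : `|z 0 j - xs 0 j| <= s.
    by rewrite zE; case: eqP => _; rewrite ?ts // normr0 ltW.
  (* Evaluation at z is a functional with moments (z_j - xs_j)^k. *)
  have := H _ s _ (moments_within_point zs); rewrite ltW // => /(_ s1).
  rewrite moment_value_point (bigD1 i) //= [\sum_(j | _) _]big1 => [|j /negPf ji].
    rewrite zE eqxx addr0 expr1 => /(le_trans (ler_norm _)).
    by have := minxs z (fun j => le_lt_trans (zs j) sr); lra.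
  by rewrite zE ji expr1 mulr0.
apply/eqP; apply/negPn/negP => Di0; have Dpos : 0 < `|D i| by rewrite normr_gt0.
have C1 : 0 < `|C| + 1 by rewrite ltr_wpDl.
(* Small enough that C s <= |D i| / 2, against |D i| <= C s. *)
pose s := Num.min (r / 2) (Num.min 1 (`|D i| / 2 / (`|C| + 1))).
have s0 : 0 < s by rewrite !lt_min ltr01 !divr_gt0.
have sr : s < r by rewrite gt_min; apply/orP; left; lra.
have s1 : s <= 1 by rewrite !ge_min lexx orbT.
have sD : s <= `|D i| / 2 / (`|C| + 1) by rewrite !ge_min lexx !orbT.
have := step s (- Num.sg (D i) * s) s0 sr s1.
rewrite normrM normrN normr_sg Di0 mul1r gtr0_norm // => /(_ erefl).
rewrite mulrA mulrN [D i * _]mulrC -normrEsg mulNr opprK.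
rewrite expr2 mulrA ler_pM2r // => DCs.
move: sD; rewrite ler_pdivlMr // => sD.
have := ler_wpM2r (ltW s0) (ler_norm C); lra.
Qed.

Lemma interior_box_radius (A : set 'rV[R]_l) xs : A xs -> ~ boundary A xs ->
  exists2 r : R, 0 < r & forall z, (forall i, `|z 0 i - xs 0 i| < r) -> A z.
Proof.
move=> Axs nbd; have /nbhs_ballP[r /= r0 rA] : nbhs xs A.
  by apply: contrapT => nint; apply: nbd; split => //; exact: subset_closure.
exists r => // z zr; apply: rA; split=> // i j; rewrite ord1.
by rewrite /ball /= distrC; exact: zr.
Qed.

Definition quadratic_enclosure xs (C : R) : Prop :=
  forall x (w : R), (forall z, box_set x z -> box_set unit_box z) ->
    0 <= w <= 1 -> (forall i, hi x i - lo x i <= w) ->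
    peval p xs - C * w ^+ 2 <= patch_min p x /\
    (box_set x xs -> patch_max p x <= peval p xs + C * w ^+ 2).

(** Centring the moments at the grid point of the entry gives the lower bound,
    centring them at xs the upper one. *)
Lemma patch_near_minimum xs :
  global_minimizer p (box_set unit_box) xs -> ~ boundary (box_set unit_box) xs ->
  exists2 C : R, 0 <= C & quadratic_enclosure xs C.
Proof.
move=> [xs_in xs_min] /(interior_box_radius xs_in)[r r0 rP].
have [C [D [C0 H]]] := moment_value_expansion p.
have D0 : forall i, D xs i = 0.
  apply: (critical_point (C := C) _ r0) => [mu w|z zr]; first exact: H.
  by apply: xs_min; exact: rP.
exists C => // x w xu w01 xw.
have entry J c : box_set x c -> `|patch p x J - peval p c -
    \sum_i D c i * bernstein_moment x J c i 1%N| <= C * w ^+ 2.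
  move=> xc; rewrite (patch_momentE x c J); apply: H; rewrite ?w01 //; first exact: xu.
  exact: moments_within_bernstein.
have min_entry J : peval p xs - C * w ^+ 2 <= patch p x J.
  have := entry J _ (grid_point_in x J).
  rewrite big1 => [|i _]; last by rewrite bernstein_moment_grid mulr0.
  have := xs_min _ (xu _ (grid_point_in x J)).
  by rewrite ler_norml subr0 => ? /andP[? _]; lra.
have max_entry J : box_set x xs -> patch p x J <= peval p xs + C * w ^+ 2.
  move=> xxs; have := entry J _ xxs.
  rewrite big1 => [|i _]; last by rewrite D0 mul0r.
  by rewrite ler_norml subr0 => /andP[_ ?]; lra.
by split=> [|xxs]; [apply: le_bigmin | apply: bigmax_le] => // *; exact: max_entry.
Qed.

End PatchBounds.

(** * The boxes kept by the algorithm *)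

Section Iterations.
Variables (R : realType) (l : nat) (p : mpoly l R).
Implicit Types (x y : box R l) (z xs : 'rV[R]_l) (L : seq (box R l)) (W : 'I_l -> R).

(** The invariant of the algorithm.  The widths are recorded per direction
    because inside an iteration only some directions have been bisected. *)
Definition tracks xs W L : Prop :=
  (forall x, x \in L -> (forall z, box_set x z -> box_set unit_box z) /\
                        forall i, hi x i - lo x i = W i) /\
  (exists2 x, x \in L & box_set x xs).

Lemma left_half_lo r x i : lo (left_half r x) i = lo x i.
Proof. by rewrite /lo /= !mxE. Qed.

Lemma left_half_hi r x i : hi (left_half r x) i = if i == r then mid x r else hi x i.
Proof. by rewrite /hi /= !mxE. Qed.

Lemma right_half_lo r x i : lo (right_half r x) i = if i == r then mid x r else lo x i.
Proof. by rewrite /lo /= !mxE. Qed.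

Lemma right_half_hi r x i : hi (right_half r x) i = hi x i.
Proof. by rewrite /hi /= !mxE. Qed.

Definition halfE := (left_half_lo, left_half_hi, right_half_lo, right_half_hi).

Lemma mid_in r x : lo x r <= mid x r <= hi x r.
Proof. by have := lo_lt_hi x r; rewrite /mid => ?; apply/andP; split; lra. Qed.

Lemma half_sub r x h : h = left_half r x \/ h = right_half r x ->
  forall z, box_set h z -> box_set x z.
Proof.
by move=> [->|->] z hz i; have := hz i; rewrite !halfE; have /andP[] := mid_in r x;
  case: eqP => // -> ? ? /andP[? ?]; apply/andP; split; lra.
Qed.

Lemma half_width r x h : h = left_half r x \/ h = right_half r x ->
  forall i, hi h i - lo h i = (hi x i - lo x i) / (if i == r then 2 else 1).
Proof.
by move=> [->|->] i; rewrite !halfE; case: eqP => [->|_]; rewrite ?divr1 // /mid; field.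
Qed.

Lemma mem_bisect r L h : h \in bisect r L <->
  exists2 x, x \in L & h = left_half r x \/ h = right_half r x.
Proof.
split=> [/flatten_mapP[x xL]|[x xL hx]].
  by rewrite !inE => /orP[] /eqP ->; exists x; auto.
by apply/flatten_mapP; exists x => //; rewrite !inE; case: hx => ->; rewrite eqxx ?orbT.
Qed.

Lemma tracks_bisect xs W L r : tracks xs W L ->
  tracks xs (fun i => W i / (if i == r then 2 else 1)) (bisect r L).
Proof.
move=> [LW [x xL xxs]]; split=> [h /mem_bisect[y yL yh]|].
  have [yu yW] := LW y yL; split=> [z /(half_sub yh)|i]; first exact: yu.
  by rewrite (half_width yh) yW.
have [xs_mid|mid_xs] := leP (xs 0 r) (mid x r);
  [exists (left_half r x) | exists (right_half r x)].
- by apply/mem_bisect; exists x; auto.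
- move=> i; rewrite !halfE; have := xxs i.
  by case: eqP => [->|//] /andP[-> _].
- by apply/mem_bisect; exists x; auto.
- move=> i; rewrite !halfE; have := xxs i.
  by case: eqP => [->|//] /andP[_ ->]; rewrite ltW.
Qed.

Lemma lower_corner_in x : box_set x (\row_i lo x i).
Proof. by move=> i; rewrite mxE lexx ltW // lo_lt_hi. Qed.

Lemma le_p_up (a : R) L : (forall x, x \in L -> a <= patch_max p x) -> (a%:E <= p_up p L)%E.
Proof.
rewrite /p_up; elim: L => [|x L IH] aL; first by rewrite big_nil leey.
rewrite big_cons le_min lee_fin aL ?mem_head //=.
by apply: IH => y yL; apply: aL; rewrite inE yL orbT.
Qed.

(** A box x containing xs is never removed: min B(x) <= p(xs), and p(xs) is at
    most p at the lower corner of any other box y, hence at most max B(y). *)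
Lemma tracks_cut_off xs W L : global_minimizer p (box_set unit_box) xs ->
  tracks xs W L -> tracks xs W (cut_off p L).
Proof.
move=> [_ xs_min] [LW [x xL xxs]]; split=> [y|].
  by rewrite mem_filter => /andP[_]; exact: LW.
exists x => //; rewrite mem_filter xL andbT /suboptimal -leNgt.
apply: le_p_up => y yL; apply: le_trans (patch_min_le_peval p xxs) _.
apply: le_trans (peval_le_patch_max p (lower_corner_in y)).
by apply: xs_min; apply: (LW y yL).1; exact: lower_corner_in.
Qed.

Lemma tracks_iteration xs W L : global_minimizer p (box_set unit_box) xs ->
  tracks xs W L -> tracks xs (fun i => W i / 2) (pcba_iteration p L).
Proof.
move=> xs_min; rewrite /pcba_iteration.
have -> : (fun i => W i / 2) = fun i => W i / 2 ^+ count_mem i (enum 'I_l).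
  by apply/funext => i; rewrite count_uniq_mem ?enum_uniq // mem_enum.
elim: (enum 'I_l) W L => [|r s IHs] W L LW.
  by rewrite (_ : (fun i => _) = W) //; apply/funext => i; rewrite divr1.
have := IHs _ _ (tracks_cut_off xs_min (tracks_bisect r LW)).
congr tracks; apply/funext => i /=; rewrite eq_sym exprD invfM mulrA.
by case: eqP.
Qed.

Lemma tracks_pcba_list xs n : global_minimizer p (box_set unit_box) xs ->
  tracks xs (fun=> 2^-1 ^+ n) (pcba_list p n).
Proof.
move=> xs_min; elim: n => [|n IHn] /=.
  split=> [x|]; last by exists unit_box; [rewrite mem_head | exact: xs_min.1].
  by rewrite inE => /eqP ->; split=> // i; rewrite /hi /lo /= !mxE subr0.
have := tracks_iteration xs_min IHn; congr tracks.
by apply/funext => i; rewrite exprSr.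
Qed.

(** The box containing xs is the witness: its upper bound exceeds the lower
    bound of any box by at most 2 C 4^-n. *)
Lemma stopping_criterion_met xs (C eps delta : R) n :
  quadratic_enclosure p xs C -> global_minimizer p (box_set unit_box) xs ->
  2^-1 ^+ n <= delta -> 2 * C * (2^-1 ^+ n) ^+ 2 <= eps ->
  stopping_criterion p eps delta (pcba_list p n).
Proof.
move=> encl xs_min le_delta le_eps.
have [LW [x xL xxs]] := tracks_pcba_list n xs_min.
have w01 : 0 <= (2^-1 ^+ n : R) <= 1.
  by rewrite exprn_ge0 // exprn_ile1 // invf_le1 // ler1n.
have bounds y : y \in pcba_list p n ->
    peval p xs - C * (2^-1 ^+ n) ^+ 2 <= patch_min p y /\
    (box_set y xs -> patch_max p y <= peval p xs + C * (2^-1 ^+ n) ^+ 2).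
  move=> yL; have [yu yW] := LW y yL.
  by apply: encl => // i; rewrite yW.
exists x; split=> // [|y yL].
  apply: bigmax_le => [|i _]; last by rewrite (LW x xL).2.
  by apply: le_trans le_delta; case/andP: w01.
by have [_ /(_ xxs)] := bounds x xL; have [+ _] := bounds y yL; lra.
Qed.

End Iterations.

(** * Logarithmic form of the tolerances *)

Lemma half_exp_le (R : realType) (a : R) n :
  0 < a -> - log2 a <= n%:R -> 2^-1 ^+ n <= a.
Proof.
move=> a0; have ln2 : 0 < ln 2 :> R by rewrite ln_gt0 // ltr1n.
rewrite /log2 -mulNr ler_pdivrMr // => le_n.
rewrite -ler_ln ?posrE ?exprn_gt0 // lnXn // lnV ?posrE // mulNrn.
by rewrite lerNl (le_trans le_n) // mulr_natl.
Qed.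

Lemma half_sqr_exp_le (R : realType) (eps K : R) n : 0 < eps -> 0 < K ->
  - 2^-1 * log2 eps + 2^-1 * log2 K <= n%:R -> K * (2^-1 ^+ n) ^+ 2 <= eps.
Proof.
move=> e0 K0 le_n; rewrite mulrC -ler_pdivlMr // -exprM.
apply: half_exp_le; first exact: divr_gt0.
move: le_n; rewrite /log2 ln_div ?posrE // natrM mulrBl; lra.
Qed.

(** * The iteration bound *)

Lemma pcba_needed_le (R : realType) (l : nat) (p : mpoly l R) (eps delta : R) k :
  stopping_criterion p eps delta (pcba_list p k) ->
  exists2 n, pcba_iterations_needed p eps delta n & (n <= k)%N.
Proof.
move=> stop_k; pose P n := `[< stopping_criterion p eps delta (pcba_list p n) >].
have exP : exists n, P n by exists k; apply/asboolP.
case: (ex_minnP exP) => n /asboolP stop_n min_n; exists n; last exact/min_n/asboolP.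
split=> // j jn stop_j.
by have := min_n j (asboolT stop_j); rewrite leqNgt jn.
Qed.

Theorem theorem15 (R : realType) (l : nat) (p : mpoly l R)
    (hmin : exists xs : 'rV[R]_l,
      [/\ global_minimizer p (box_set unit_box) xs,
          ~ boundary (box_set unit_box) xs
        & posdefmx (hessian p xs)]) :
  exists C1 C2 : R, forall eps delta : R, 0 < eps -> 0 < delta ->
    exists n : nat, pcba_iterations_needed p eps delta n /\
      (n%:Z <= Num.ceil (Num.max (- log2 delta)
                          (Num.max C1 (- 2^-1 * log2 eps + C2))))%R.
Proof.
have [xs [xs_min xs_int _]] := hmin.
have [C C0 encl] := patch_near_minimum xs_min xs_int.
(* Adding 1 keeps K positive, so that log2 K is meaningful. *)
pose K : R := 2 * C + 1; have K0 : 0 < K by rewrite /K; lra.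
(* With C1 = 0 the maximum is nonnegative and its ceiling is a natural number. *)
exists 0, (2^-1 * log2 K) => eps delta eps0 delta0.
set M := Num.max _ _.
have M0 : 0 <= M by rewrite !le_max lexx orbT.
have [k kM] : exists k : nat, Num.ceil M = k%:Z.
  exists `|Num.ceil M|%N; rewrite gez0_abs //.
  by rewrite ceil_ge0 (lt_le_trans _ M0) // ltrN10.
have Mk : M <= k%:R by have := ceil_ge M; rewrite kM.
have stop_k : stopping_criterion p eps delta (pcba_list p k).
  apply: (stopping_criterion_met encl xs_min).
    by apply: half_exp_le => //; apply: le_trans Mk; rewrite le_max lexx.
  have : K * (2^-1 ^+ k) ^+ 2 <= eps.
    by apply: half_sqr_exp_le => //; apply: le_trans Mk; rewrite !le_max lexx !orbT.
  apply: le_trans; rewrite ler_wpM2r ?sqr_ge0 //.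
  by rewrite /K; lra.
have [n needed nk] := pcba_needed_le stop_k.
by exists n; split=> //; rewrite kM lez_nat.
Qed.
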